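(* Let $H$ be a complex Hilbert space, and let $\{f_k\}_{k=1}^\infty$ and $\{g_k\}_{k=1}^\infty$ be sequences in $H$ such that $\{g_k\}_{k=1}^\infty$ is a Bessel sequence with bound $B'$. Assume that there exists $M>0$ such that $\sum_{k=1}^\infty \|f_k\|^2\le M$. Then the cross-Gram operator $G$ associated to $\{\langle f_k,g_j\rangle\}_{j,k=1}^\infty$ is a well-defined, bounded and compact operator on $\ell^2(\mathbb{N})$.
   Context: Inner products are linear in the first argument. A sequence $\{g_k\}_{k=1}^\infty\subset H$ is a Bessel sequence with bound $B'>0$ if $\sum_{k=1}^\infty|\langle f,g_k\rangle|^2\le B'\|f\|^2$ for all $f\in H$. The cross-Gram operator $G$ associated to $\{\langle f_k,g_j\rangle\}_{j,k=1}^\infty$ is the operator on $\ell^2(\mathbb{N})$ given by the matrix whose $(j,k)$ entry is $\langle f_k,g_j\rangle$, i.e. $G\{c_k\}_{k=1}^\infty=\left\{\sum_{k=1}^\infty c_k\langle f_k,g_j\rangle\right\}_{j=1}^\infty$. It is well-defined if for every $\{c_k\}\in\ell^2(\mathbb{N})$ these series converge and the resulting sequence lies in $\ell^2(\mathbb{N})$. *)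

(* Defs.v *)
From HB Require Import structures.
From mathcomp Require Import all_boot all_order all_algebra sesquilinear.
From mathcomp Require Import all_classical all_reals all_analysis.
From mathcomp Require Import complex ring.

Set Implicit Arguments.
Unset Strict Implicit.
Unset Printing Implicit Defensive.

Import Order.TTheory GRing.Theory Num.Theory.
Import numFieldNormedType.Exports.

Local Open Scope classical_set_scope.
Local Open Scope ring_scope.
Local Open Scope complex_scope.

(* R[i] does not inherit the norm topology that the library puts on a generic
   numFieldType, so it has to be copied explicitly. *)
HB.instance Definition _ (R : realType) := NormedModule.copy R[i] R[i]^o.

(* In a normed module over R[i] the norm `|x| is an element of R[i] (a
   nonnegative real one); rnorm x is that number seen in R. *)
Definition rnorm (R : realType) (V : normedZmodType R[i]) (x : V) : R :=
  complex.Re `|x|.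

Section rnorm_theory.
Variables (R : realType) (V : normedZmodType R[i]).
Implicit Types x y : V.

Lemma rnormE x : (rnorm x)%:C = `|x|.
Proof. by rewrite /rnorm RRe_real// normr_real. Qed.

Lemma rnorm_ge0 x : 0 <= rnorm x.
Proof. by rewrite -ler0c rnormE. Qed.

Lemma ler_rnormD x y : rnorm (x + y) <= rnorm x + rnorm y.
Proof. by rewrite -lecR rmorphD /= !rnormE ler_normD. Qed.

Lemma rnorm0 : rnorm (0 : V) = 0.
Proof. by rewrite /rnorm normr0. Qed.

Lemma rnorm_eq0 x : rnorm x = 0 -> x = 0.
Proof. by move=> x0; apply/normr0_eq0; rewrite -rnormE x0. Qed.

End rnorm_theory.

Lemma rnormM (R : realType) (a b : R[i]) : rnorm (a * b) = rnorm a * rnorm b.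
Proof. by apply: complexI; rewrite rmorphM /= !rnormE normrM. Qed.

Section sqnorm.
Variable R : realType.
Implicit Types (c d : nat -> R[i]) (a : R[i]).

Definition sqnorm c : \bar R := (\sum_(0 <= k <oo) ((rnorm (c k)) ^+ 2)%:E)%E.

Lemma sqnorm_ge0 c : (0 <= sqnorm c)%E.
Proof. by apply: nneseries_ge0 => k _ _; rewrite lee_fin sqr_ge0. Qed.

Lemma sqnorm0 : sqnorm 0 = 0%E.
Proof. by apply: eseries0 => k _ _ /=; rewrite rnorm0 expr0n. Qed.

Lemma sqnormZ a c : sqnorm (a *: c) = ((rnorm a ^+ 2)%:E * sqnorm c)%E.
Proof.
rewrite /sqnorm -nneseriesZl => [|k _]; last by rewrite lee_fin sqr_ge0.
by apply: eq_eseriesr => k _; rewrite -EFinM -exprMn -rnormM.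
Qed.

Lemma sqnormD (t : R) c d : 0 < t ->
  (sqnorm (c + d)%R <= (1 + t)%:E * sqnorm c + (1 + t^-1)%:E * sqnorm d)%E.
Proof.
move=> t0.
have ti0 : 0 < t^-1 by rewrite invr_gt0.
rewrite /sqnorm -!nneseriesZl; try by move=> k _; rewrite lee_fin sqr_ge0.
rewrite -nneseriesD; try by move=> k _ _; rewrite -EFinM lee_fin mulr_ge0// ?sqr_ge0// addr_ge0// ltW.
apply: lee_nneseries => k _; first by rewrite lee_fin sqr_ge0.
rewrite -!EFinM -EFinD lee_fin.
apply: (@le_trans _ _ ((rnorm (c k) + rnorm (d k)) ^+ 2)).
  by rewrite ler_sqr ?nnegrE ?rnorm_ge0 ?addr_ge0 ?rnorm_ge0// ler_rnormD.
rewrite -subr_ge0; set x := rnorm (c k); set y := rnorm (d k).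
have -> : (1 + t) * x ^+ 2 + (1 + t^-1) * y ^+ 2 - (x + y) ^+ 2
    = t^-1 * (t * x - y) ^+ 2 by field; rewrite gt_eqF.
by rewrite mulr_ge0 ?sqr_ge0// ltW.
Qed.

Lemma sqnorm_eq0 c : sqnorm c = 0%E -> c = 0.
Proof.
move=> c0; apply/funext => k; apply: rnorm_eq0; apply/eqP.
rewrite -sqrf_eq0 eq_le sqr_ge0 andbT.
suff : (((rnorm (c k)) ^+ 2)%:E <= sqnorm c)%E by rewrite c0 lee_fin.
rewrite /sqnorm (@nneseriesD1 _ _ k) => // [|n _]; last by rewrite lee_fin sqr_ge0.
by rewrite leeDl// nneseries_ge0// => n _ _; rewrite lee_fin sqr_ge0.
Qed.

End sqnorm.

Section ell2.
Variable R : realType.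

Definition square_summable : {pred nat -> R[i]} :=
  fun c => (sqnorm c < +oo)%E.

Lemma square_summable_submod_closed : submod_closed square_summable.
Proof.
split=> [|a c d]; first by rewrite unfold_in sqnorm0 ltry.
rewrite !unfold_in => coo doo.
apply: le_lt_trans (sqnormD _ _ ltr01) _.
rewrite sqnormZ.
have cfin : sqnorm c \is a fin_num by rewrite ge0_fin_numE// sqnorm_ge0.
have dfin : sqnorm d \is a fin_num by rewrite ge0_fin_numE// sqnorm_ge0.
by rewrite ltey_eq fin_numD !fin_numM.
Qed.

HB.instance Definition _ :=
  GRing.isSubmodClosed.Build _ _ square_summable square_summable_submod_closed.

Record ell2 := Ell2 {
  ell2_seq :> nat -> R[i];
  ell2P : ell2_seq \in square_summable }.

HB.instance Definition _ := [isSub for ell2_seq].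
HB.instance Definition _ := [Choice of ell2 by <:].
HB.instance Definition _ := [SubChoice_isSubLmodule of ell2 by <:].

Definition ell2_norm (c : ell2) : R[i] := (Num.sqrt (fine (sqnorm c)))%:C.

Lemma sqnorm_fin (c : ell2) : sqnorm c \is a fin_num.
Proof. by rewrite ge0_fin_numE ?sqnorm_ge0//; exact: (ell2P c). Qed.

Lemma fine_sqnorm_ge0 (c : ell2) : 0 <= fine (sqnorm c).
Proof. by rewrite fine_ge0// sqnorm_ge0. Qed.

Lemma ell2_norm0_eq0 (c : ell2) : ell2_norm c = 0 -> c = 0.
Proof.
move=> /(congr1 (@complex.Re R)) /= /eqP; rewrite sqrtr_eq0 => c0.
apply/val_inj/sqnorm_eq0; rewrite -(fineK (sqnorm_fin c)); congr EFin.
by apply/eqP; rewrite eq_le c0 fine_sqnorm_ge0.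
Qed.

Lemma ell2_normZ (a : R[i]) (c : ell2) : ell2_norm (a *: c) = `|a| * ell2_norm c.
Proof.
rewrite /ell2_norm -rnormE -rmorphM /=; congr (_%:C).
rewrite sqnormZ -(fineK (sqnorm_fin c)) -EFinM /= sqrtrM ?sqr_ge0//.
by rewrite sqrtr_sqr ger0_norm// rnorm_ge0.
Qed.

Lemma ler_ell2_normD (c d : ell2) :
  ell2_norm (c + d) <= ell2_norm c + ell2_norm d.
Proof.
have n0 : ell2_norm 0 = 0 by rewrite -(scale0r 0) ell2_normZ normr0 mul0r.
have [->|cn0] := eqVneq c 0; first by rewrite n0 !add0r.
have [->|dn0] := eqVneq d 0; first by rewrite n0 !addr0.
rewrite /ell2_norm -rmorphD lecR.
set A := Num.sqrt (fine (sqnorm c)); set B := Num.sqrt (fine (sqnorm d)).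
have A0 : 0 < A.
  rewrite lt_def sqrtr_ge0 andbT; apply: contra_neq cn0 => A0.
  by apply: ell2_norm0_eq0; rewrite /ell2_norm -/A A0.
have B0 : 0 < B.
  rewrite lt_def sqrtr_ge0 andbT; apply: contra_neq dn0 => B0.
  by apply: ell2_norm0_eq0; rewrite /ell2_norm -/B B0.
have AB0 : 0 <= A + B by rewrite addr_ge0 ?sqrtr_ge0.
rewrite -(ger0_norm AB0) -sqrtr_sqr; apply: ler_wsqrtr.
have := sqnormD c d (divr_gt0 B0 A0).
rewrite -(fineK (sqnorm_fin c)) -(fineK (sqnorm_fin d)).
rewrite -[X in (X <= _)%E](fineK (sqnorm_fin (c + d))).
rewrite -!EFinM -EFinD lee_fin => /le_trans; apply.
rewrite -[fine (sqnorm c)]sqr_sqrtr ?fine_sqnorm_ge0// -/A.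
rewrite -[fine (sqnorm d)]sqr_sqrtr ?fine_sqnorm_ge0// -/B.
rewrite le_eqVlt; apply/orP; left; apply/eqP; field.
by rewrite !gt_eqF.
Qed.

HB.instance Definition _ := Lmodule_isNormed.Build R[i] ell2
  ler_ell2_normD ell2_normZ ell2_norm0_eq0.

End ell2.

Section operators.
Variables (R : realType) (V W : normedModType R[i]).

Definition bounded_operator (T : {linear V -> W}) : Prop :=
  exists C : R, forall x : V, rnorm (T x) <= C * rnorm x.

(* precompact A means that the closure of A is compact (lemma precompactE). *)
Definition compact_operator (T : {linear V -> W}) : Prop :=
  forall A : set V, bounded_set A -> precompact (T @` A).

End operators.

Section matrix_operator.
Variable R : realType.

(* a j k is the entry in row j and column k; limn is a junk value when the
   series diverges, which well_defined_on_ell2 excludes. *)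
Definition matrix_apply (a : nat -> nat -> R[i]) (c : nat -> R[i]) : nat -> R[i] :=
  fun j => limn (series (fun k => c k * a j k)).

Definition well_defined_on_ell2 (a : nat -> nat -> R[i]) : Prop :=
  forall c : ell2 R,
    (forall j, cvgn (series (fun k => c k * a j k))) /\
    matrix_apply a c \in @square_summable R.

Variables (a : nat -> nat -> R[i]) (wd : well_defined_on_ell2 a).

Definition matrix_operator (c : ell2 R) : ell2 R := Ell2 (wd c).2.

Lemma matrix_operator_is_linear : linear matrix_operator.
Proof.
move=> l c d; apply/val_inj/funext => j /=.
have cvc := (wd c).1 j; have cvd := (wd d).1 j.
change (matrix_apply a (l *: c + d : ell2 R) j
  = l * matrix_apply a c j + matrix_apply a d j).
have slin : series (fun k => (l *: c + d : ell2 R) k * a j k) =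
    (fun n => l * series (fun k => c k * a j k) n + series (fun k => d k * a j k) n).
  apply/funext => n; rewrite /series /= mulr_sumr -big_split /=.
  by apply: eq_bigr => k _; rewrite mulrDl mulrA.
apply: (cvg_lim (@norm_hausdorff R[i] R[i])); rewrite slin.
exact: (@cvgD R[i] R[i] _ _ _ _ _ _ _ (@cvgMl_tmp _ _ _ _ _ l _ cvc) cvd).
Qed.

HB.instance Definition _ := GRing.isLinear.Build R[i] (ell2 R) (ell2 R) _
  matrix_operator matrix_operator_is_linear.

End matrix_operator.

Section frames.
Variables (R : realType) (H : normedModType R[i]) (ip : H -> H -> R[i]).

Definition bessel_sequence (g : nat -> H) (B : R) : Prop :=
  0 < B /\ forall x : H,
    (\sum_(0 <= k <oo) (rnorm (ip x (g k)) ^+ 2)%:E <= (B * rnorm x ^+ 2)%:E)%E.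

Definition cross_gram (f g : nat -> H) : nat -> nat -> R[i] :=
  fun j k => ip (f k) (g j).

End frames.

(* Main.v *)
Require Import Defs.
From HB Require Import structures.
From mathcomp Require Import all_boot all_order all_algebra sesquilinear.
From mathcomp Require Import all_classical all_reals all_analysis.
From mathcomp Require Import complex ring lra.

Set Implicit Arguments.
Unset Strict Implicit.
Unset Printing Implicit Defensive.

Import Order.TTheory GRing.Theory Num.Theory.
Import numFieldNormedType.Exports.

Local Open Scope classical_set_scope.
Local Open Scope ring_scope.
Local Open Scope complex_scope.

(* The Bessel bound applied to each f_k, with the two sums interchanged, gives
   sum_(j,k) |<f_k, g_j>|^2 <= B' sum_k ||f_k||^2 < oo, i.e. the matrix is
   Hilbert-Schmidt. By Cauchy-Schwarz the j-th entry of G c is at most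
   ||c|| r_j in modulus, where r_j is the l^2 norm of the j-th row and r is
   square summable: hence G is well defined and bounded, and it maps the ball
   of radius K into the Hilbert cube {y | |y_j| <= K r_j}. That cube lies in
   the continuous image of a product of real segments, which is compact by
   Tychonoff; no completeness of l^2 is needed. *)

(** * Limits and absolute convergence over [R[i]], through real-valued norms *)

Lemma cvg_rnormP (R : realType) (V : normedModType R[i]) (T : Type)
    (F : set_system T) (FF : Filter F) (f : T -> V) (l : V) :
  f @ F --> l <->
  forall e : R, 0 < e -> \forall x \near F, rnorm (l - f x) < e.
Proof.
split=> [/cvgrPdist_lt fl e e0|fl].
  have := fl e%:C; rewrite ltcR => /(_ e0); apply: filterS => x.
  by rewrite -rnormE ltcR.
apply/cvgrPdist_lt => e e0.
(* In the order of [R[i]] a positive element is real, so [e] is the image of its real part. *)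
have eE : (complex.Re e)%:C = e by rewrite RRe_real// gtr0_real.
have : 0 < complex.Re e by rewrite -ltcR eE.
by move=> /fl; apply: filterS => x; rewrite -rnormE -{2}eE ltcR.
Qed.

Lemma rnorm_sqr (R : realType) (z : R[i]) :
  rnorm z ^+ 2 = complex.Re z ^+ 2 + complex.Im z ^+ 2.
Proof. by apply: complexI; rewrite add_Re2_Im2 rmorphXn /= rnormE. Qed.

Lemma ler_rnorm_ReIm (R : realType) (z : R[i]) :
  rnorm z <= `|complex.Re z| + `|complex.Im z|.
Proof.
rewrite -ler_sqr ?nnegrE ?rnorm_ge0 ?addr_ge0// rnorm_sqr sqrrD !real_normK ?num_real//.
by rewrite -addrA addrCA addrC -addrA lerD2l lerDl mulrn_wge0// mulr_ge0.
Qed.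

Lemma normr_Re_le (R : realType) (z : R[i]) : `|complex.Re z| <= rnorm z.
Proof.
by rewrite -ler_sqr ?nnegrE ?rnorm_ge0// rnorm_sqr real_normK ?num_real// lerDl sqr_ge0.
Qed.

Lemma normr_Im_le (R : realType) (z : R[i]) : `|complex.Im z| <= rnorm z.
Proof.
by rewrite -ler_sqr ?nnegrE ?rnorm_ge0// rnorm_sqr real_normK ?num_real// lerDr sqr_ge0.
Qed.

Lemma cvg_complex (R : realType) (T : Type) (F : set_system T) (FF : Filter F)
    (u : T -> R[i]) (l : R[i]) :
  (fun x => complex.Re (u x)) @ F --> complex.Re l ->
  (fun x => complex.Im (u x)) @ F --> complex.Im l -> u @ F --> l.
Proof.
move=> /cvgrPdist_lt ure /cvgrPdist_lt uim.
apply/cvg_rnormP => e e0; have e20 : 0 < e / 2 by rewrite divr_gt0.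
apply: filterS2 (ure _ e20) (uim _ e20) => x.
have := ler_rnorm_ReIm (l - u x); rewrite !raddfB /=; lra.
Qed.

Lemma rnorm_lim_le (R : realType) (V : normedModType R[i]) (u : nat -> V)
    (l : V) (b : R) :
  u @ \oo --> l -> (forall n, rnorm (u n) <= b) -> rnorm l <= b.
Proof.
move=> /cvg_rnormP ul ub; apply/ler_addgt0Pr => e /ul [N _ /(_ N (leqnn N))] lN.
have := ler_rnormD (l - u N) (u N); rewrite subrK.
have := ub N; move: lN => /=; lra.
Qed.

(** The moduli dominate the real and imaginary parts, so both real series converge absolutely; the
    complex limit is assembled from their sums. *)
Lemma is_cvg_series_rnorm (R : realType) (u : nat -> R[i]) :
  cvgn (series (fun k => rnorm (u k))) -> cvgn (series u).
Proof.
move=> cu.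
have cre : cvgn (series (fun k => complex.Re (u k))).
  apply: normed_cvg; apply: (series_le_cvg _ _ _ cu) => k //=; first exact: rnorm_ge0.
  exact: normr_Re_le.
have cim : cvgn (series (fun k => complex.Im (u k))).
  apply: normed_cvg; apply: (series_le_cvg _ _ _ cu) => k //=; first exact: rnorm_ge0.
  exact: normr_Im_le.
apply/cvg_ex; exists (limn (series (fun k => complex.Re (u k)))
  +i* limn (series (fun k => complex.Im (u k)))).
apply: cvg_complex => /=.
  by under eq_fun do rewrite /series /= raddf_sum /=.
by under eq_fun do rewrite /series /= raddf_sum /=.
Qed.

(** * Cauchy-Schwarz and the pairing of square-summable sequences *)

(** The sum of the squares (Y x_k - S y_k)^2 expands to Y (X Y - S^2), which is therefore
    nonnegative. If Y > 0, divide by Y; if Y = 0, every y_k vanishes and so does S. *)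
Lemma sum_CauchySchwarz (R : realType) (x y : nat -> R) (n : nat) :
  (\sum_(0 <= k < n) x k * y k) ^+ 2 <=
  (\sum_(0 <= k < n) x k ^+ 2) * (\sum_(0 <= k < n) y k ^+ 2).
Proof.
set S := \sum_(0 <= k < n) x k * y k.
set X := \sum_(0 <= k < n) x k ^+ 2; set Y := \sum_(0 <= k < n) y k ^+ 2.
have Y0 : 0 <= Y by apply: sumr_ge0 => k _; rewrite sqr_ge0.
have key : 0 <= Y * (X * Y - S ^+ 2).
  suff -> : Y * (X * Y - S ^+ 2) = \sum_(0 <= k < n) (Y * x k - S * y k) ^+ 2.
    by apply: sumr_ge0 => k _; rewrite sqr_ge0.
  under eq_bigr do rewrite sqrrB !exprMn.
  rewrite big_split /= sumrB -!mulr_sumr -/X -/Y.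
  have -> : \sum_(0 <= k < n) Y * x k * (S * y k) *+ 2 = (Y * S * S) *+ 2.
    rewrite sumrMnl; congr (_ *+ 2); rewrite {3}/S mulr_sumr.
    by apply: eq_bigr => k _; ring.
  by ring.
move: Y0; rewrite le_eqVlt => /predU1P[Y0|Y0]; last first.
  by rewrite pmulr_rge0// subr_ge0 in key.
have y0 k : (k < n)%N -> y k = 0.
  move=> kn; apply/eqP; rewrite -sqrf_eq0 eq_le sqr_ge0 andbT Y0 /Y.
  rewrite big_mkord (bigD1 (Ordinal kn)) //= lerDl.
  by apply: sumr_ge0 => i _; rewrite sqr_ge0.
rewrite -Y0 mulr0 /S big_nat big1 ?expr0n// => k /andP[_ kn].
by rewrite y0// mulr0.
Qed.

Lemma sum_le_fine_sqnorm (R : realType) (d : nat -> R[i]) n : (sqnorm d < +oo)%E ->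
  \sum_(0 <= k < n) rnorm (d k) ^+ 2 <= fine (sqnorm d).
Proof.
move=> doo; rewrite -lee_fin fineK ?ge0_fin_numE ?sqnorm_ge0//.
rewrite -sumEFin; apply: nneseries_lim_ge => k _ _.
by rewrite lee_fin sqr_ge0.
Qed.

Section pairing.
Variables (R : realType) (c a : nat -> R[i]).
Hypotheses (coo : (sqnorm c < +oo)%E) (aoo : (sqnorm a < +oo)%E).

(** Absolute convergence by comparison: (|c_k| - |a_k|)^2 >= 0 gives |c_k| |a_k| <= |c_k|^2 +
    |a_k|^2. *)
Lemma is_cvg_series_mul : cvgn (series (fun k => c k * a k)).
Proof.
apply: is_cvg_series_rnorm.
have cc : cvgn (series (fun k => rnorm (c k) ^+ 2)).
  by apply: nnseries_is_cvg => // k; rewrite sqr_ge0.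
have ca : cvgn (series (fun k => rnorm (a k) ^+ 2)).
  by apply: nnseries_is_cvg => // k; rewrite sqr_ge0.
apply: series_le_cvg (is_cvg_seriesD cc ca) => k /=; first exact: rnorm_ge0.
  by rewrite addr_ge0// sqr_ge0.
rewrite fctE rnormM; have := sqr_ge0 (rnorm (c k) - rnorm (a k)).
have := rnorm_ge0 (c k); have := rnorm_ge0 (a k).
by rewrite sqrrB; set x := rnorm _; set y := rnorm _; nra.
Qed.

(** Finite Cauchy-Schwarz bounds every partial sum by a quantity independent of n, and the bound
    survives in the limit. Square roots are taken because [rnorm_lim_le] concerns the norm
    itself. *)
Lemma rnorm_lim_series_mul_le :
  rnorm (limn (series (fun k => c k * a k))) ^+ 2
    <= fine (sqnorm c) * fine (sqnorm a).
Proof.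
have p0 : 0 <= fine (sqnorm c) * fine (sqnorm a).
  by rewrite mulr_ge0// fine_ge0// sqnorm_ge0.
suff : rnorm (limn (series (fun k => c k * a k)))
    <= Num.sqrt (fine (sqnorm c) * fine (sqnorm a)).
  by rewrite -ler_sqr ?nnegrE ?rnorm_ge0 ?sqrtr_ge0// sqr_sqrtr.
apply: rnorm_lim_le is_cvg_series_mul _ => n.
rewrite -ler_sqr ?nnegrE ?rnorm_ge0 ?sqrtr_ge0// sqr_sqrtr//.
apply: (@le_trans _ _ ((\sum_(0 <= k < n) rnorm (c k) * rnorm (a k)) ^+ 2)).
  rewrite ler_sqr ?nnegrE ?rnorm_ge0//; last first.
    by apply: sumr_ge0 => k _; rewrite mulr_ge0 ?rnorm_ge0.
  rewrite /series /=; elim: n => [|n IHn]; first by rewrite !big_geq// rnorm0.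
  rewrite !big_nat_recr//=; apply: le_trans (ler_rnormD _ _) _.
  by rewrite rnormM lerD2r.
apply: le_trans (sum_CauchySchwarz _ _ _) _.
by apply: ler_pM; try exact: sum_le_fine_sqnorm;
  apply: sumr_ge0 => k _; rewrite sqr_ge0.
Qed.

End pairing.

Lemma fine_sqnormE (R : realType) (c : ell2 R) : fine (sqnorm c) = rnorm c ^+ 2.
Proof. by rewrite /rnorm /= sqr_sqrtr ?fine_sqnorm_ge0. Qed.

(** * Compactness of the Hilbert cube *)

Section hilbert_cube.
Variables (R : realType) (s : nat -> R).
Hypothesis soo : (\sum_(0 <= j <oo) (s j ^+ 2)%:E < +oo)%E.

(* The junk value 0 is taken when the sequence is not square summable. *)
Definition ell2_of_ReIm (p : nat * bool -> R) : ell2 R :=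
  insubd 0 (fun j => p (j, true) +i* p (j, false)).

Local Notation PT := (prod_topology (fun _ : nat * bool => (R : topologicalType))).

(** Bounding real parts (index [true]) and imaginary parts (index [false]) separately yields a
    product of real segments. Its image contains the cube, with moduli allowed up to sqrt(2) s_j. *)
Let box : set (nat * bool -> R) := [set p | forall i, `[- s i.1, s i.1]%classic (p i)].

Let sqr_sub_le (x y t : R) : - t <= x <= t -> - t <= y <= t ->
  (x - y) ^+ 2 <= 4 * t ^+ 2.
Proof. by move=> /andP[? ?] /andP[? ?]; nra. Qed.

(** On the box |y_j|^2 <= 2 s_j^2, so the sequence is square summable and the junk value is never
    taken. *)
Lemma ell2_of_ReImE p : box p ->
  ell2_of_ReIm p = (fun j => p (j, true) +i* p (j, false)) :> (nat -> R[i]).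
Proof.
move=> bp; rewrite /ell2_of_ReIm -[LHS]/(\val _) val_insubd ifT//.
rewrite unfold_in; apply: (@le_lt_trans _ _ (2%:E * \sum_(0 <= j <oo) (s j ^+ 2)%:E)%E).
  rewrite -nneseriesZl => [|j _]; last by rewrite lee_fin sqr_ge0.
  apply: lee_nneseries => j _; first by rewrite lee_fin sqr_ge0.
  rewrite -EFinM lee_fin rnorm_sqr /=.
  have := bp (j, true); have := bp (j, false); rewrite /= !in_itv /=.
  by move=> /andP[? ?] /andP[? ?]; nra.
by rewrite lte_mul_pinfty// lee_fin.
Qed.

Let dist2 (p q : nat * bool -> R) (j : nat) : R :=
  (p (j, true) - q (j, true)) ^+ 2 + (p (j, false) - q (j, false)) ^+ 2.

(** The product topology only controls finitely many coordinates at a time; the uniform domination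
    by [s] on the box is what upgrades this to control of the l^2 norm. *)
Lemma continuous_ell2_of_ReIm :
  {within (box : set PT),
    continuous ell2_of_ReIm}.
Proof.
(* Split the series at N: beyond N it is dominated by the tail of 8 s_j^2,
   before N it is a finite sum of coordinatewise continuous terms. *)
apply/subspace_continuousP => p bp.
have nF : Filter (nbhs (p : PT)) by exact: (@nbhs_filter PT).
 apply/cvg_rnormP => e e0.
have d2_ge0 q j : 0 <= dist2 p q j by rewrite addr_ge0// sqr_ge0.
have e20 : 0 < e ^+ 2 / 2 by rewrite divr_gt0// exprn_gt0.
have [N tailN] : exists N, (\sum_(N <= j <oo) (8 * s j ^+ 2)%:E < (e ^+ 2 / 2)%:E)%E.
  have tail0 : (\sum_(0 <= j <oo) (8 * s j ^+ 2)%:E < +oo)%E.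
    under eq_eseriesr do rewrite EFinM.
    rewrite nneseriesZl; last by move=> j _; rewrite lee_fin sqr_ge0.
    by rewrite lte_mul_pinfty// lee_fin.
  have := nneseries_tail_cvg tail0.
  have ge0 k : true -> (0 <= (8 * s k ^+ 2)%:E)%E.
    by move=> _; rewrite lee_fin mulr_ge0// sqr_ge0.
  move=> /(_ ge0) /fine_cvgP [] [N0 _ finN] /cvgrPdist_lt /(_ _ e20) [N1 _ ltN].
  (* Tails are finite from [N0] on, and their real values are below e^2/2 from [N1] on. *)
  exists (maxn N0 N1).
  have := ltN (maxn N0 N1) (leq_maxr _ _); have := finN (maxn N0 N1) (leq_maxl _ _).
  rewrite /= sub0r normrN => fin.
  rewrite ger0_norm => [|]; last by apply: fine_ge0; apply: nneseries_ge0 => k _; exact: ge0.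
  by rewrite -lte_fin fineK.
have head : \forall q \near (p : PT),
    \sum_(0 <= j < N) dist2 p q j < e ^+ 2 / 2.
  have cv : (fun q => \sum_(0 <= j < N) dist2 p q j) @
      (p : PT) --> \sum_(0 <= j < N) (0 : R).
    apply: cvg_big => [|j _]; first exact: add_continuous.
    have cvi b : (fun q : PT =>
        (p (j, b) - q (j, b)) ^+ 2) @
        (p : PT) --> (0 : R).
      have cvd : (fun q : PT => p (j, b) - q (j, b)) @ (p : PT) --> (0 : R).
        rewrite -(subrr (p (j, b))); apply: cvgB; first exact: cvg_cst.
        exact: (@proj_continuous _ (fun=> R : topologicalType) (j, b)).
      by have := cvgM cvd cvd; rewrite mul0r => /(_ nF).
    by have := cvgD (cvi true) (cvi false); rewrite addr0 => /(_ nF).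
  move: cv; rewrite big1// => /cvgrPdist_lt /(_ _ e20); apply: filterS => q.
  by rewrite sub0r normrN ger0_norm// sumr_ge0.
rewrite near_withinE; apply: filterS head => q headq bq.
rewrite -ltr_sqr ?nnegrE ?rnorm_ge0 ?ltW// -fine_sqnormE -lte_fin fineK ?sqnorm_fin//.
have -> : sqnorm (ell2_of_ReIm p - ell2_of_ReIm q) = (\sum_(0 <= j <oo) (dist2 p q j)%:E)%E.
  apply: eq_eseriesr => j _; congr (_%:E).
  change (rnorm (ell2_seq (ell2_of_ReIm p) j - ell2_seq (ell2_of_ReIm q) j) ^+ 2 = dist2 p q j).
  by rewrite !ell2_of_ReImE// rnorm_sqr.
rewrite (@nneseries_split _ _ 0 N) => [|k _]; last by rewrite lee_fin.
rewrite add0n sumEFin (splitr (e ^+ 2)) EFinD lteD// ?lte_fin//.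
apply: le_lt_trans tailN; apply: lee_nneseries => j _; first by rewrite lee_fin.
rewrite lee_fin /dist2; have := bp (j, true); have := bp (j, false).
have := bq (j, true); have := bq (j, false); rewrite /= !in_itv /= => ? ? ? ?.
(* Two points of [-s_j, s_j] are at most 2 s_j apart, so the real and the imaginary part contribute
   at most 4 s_j^2 each. *)
have -> : 8 * s j ^+ 2 = 4 * s j ^+ 2 + 4 * s j ^+ 2 by ring.
by apply: lerD; exact: sqr_sub_le.
Qed.

(** Precompactness passes to subsets, so it suffices to place the cube inside the compact image of
    the box. *)
Lemma precompact_hilbert_cube :
  precompact [set y : ell2 R | forall j, rnorm (y j) <= s j].
Proof.
apply: (@precompact_subset _ _ (ell2_of_ReIm @` box)).
  move=> y ys /=; pose p (i : nat * bool) :=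
    if i.2 then complex.Re (y i.1) else complex.Im (y i.1).
  have bp : box p.
    move=> [j b]; rewrite /= in_itv /= -ler_norml; apply: le_trans (ys j).
    by case: b; rewrite /p /= ?normr_Re_le ?normr_Im_le.
  exists p => //; apply/val_inj/funext => j.
  by rewrite -[LHS]/(ell2_seq _ j) ell2_of_ReImE// /p /= /p /=; case: (y j).
apply: compact_precompact; first exact: norm_hausdorff.
apply: (@continuous_compact PT);
  first exact: continuous_ell2_of_ReIm.
apply: (@tychonoff _ (fun=> R : topologicalType) (fun i => `[- s i.1, s i.1]%classic)).
by move=> i; exact: segment_compact.
Qed.

End hilbert_cube.

(** * Hilbert-Schmidt matrices acting on l^2 *)

Section hilbert_schmidt.
Variables (R : realType) (a : nat -> nat -> R[i]).
Hypothesis aoo : (\sum_(0 <= j <oo) sqnorm (a j) < +oo)%E.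

Let row_lty j : (sqnorm (a j) < +oo)%E.
Proof.
apply: le_lt_trans aoo; rewrite (@nneseriesD1 _ _ j) => // [|k _]; last exact: sqnorm_ge0.
by rewrite leeDl// nneseries_ge0// => k _ _; exact: sqnorm_ge0.
Qed.

Let row_fin j : (fine (sqnorm (a j)))%:E = sqnorm (a j).
Proof. by rewrite fineK// ge0_fin_numE ?sqnorm_ge0. Qed.

Let rnorm_apply_le (c : ell2 R) j :
  rnorm (matrix_apply a c j) ^+ 2 <= rnorm c ^+ 2 * fine (sqnorm (a j)).
Proof. by rewrite -fine_sqnormE; apply: rnorm_lim_series_mul_le => //; exact: (ell2P c). Qed.

(** Summing the entrywise bounds over the rows gives one estimate that serves both square
    summability of the image and boundedness. *)
Let sqnorm_apply_le (c : ell2 R) : (sqnorm (matrix_apply a c) <=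
  (rnorm c ^+ 2)%:E * \sum_(0 <= j <oo) sqnorm (a j))%E.
Proof.
rewrite -nneseriesZl => [|j _]; last exact: sqnorm_ge0.
apply: lee_nneseries => j _; first by rewrite lee_fin sqr_ge0.
by rewrite -row_fin -EFinM lee_fin rnorm_apply_le.
Qed.

Lemma hilbert_schmidt_well_defined : well_defined_on_ell2 a.
Proof.
move=> c; split=> [j|].
  by apply: is_cvg_series_mul => //; exact: (ell2P c).
rewrite unfold_in; apply: le_lt_trans (sqnorm_apply_le c) _.
by rewrite lte_mul_pinfty// lee_fin sqr_ge0.
Qed.

Lemma hilbert_schmidt_bounded (wd : well_defined_on_ell2 a) :
  bounded_operator (matrix_operator wd).
Proof.
(* The constant is the Hilbert-Schmidt norm of [a]; [fine] is faithful here since [aoo] makes the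
   sum finite. *)
exists (Num.sqrt (fine (\sum_(0 <= j <oo) sqnorm (a j))%E)) => c.
have S0 : (0 <= \sum_(0 <= j <oo) sqnorm (a j))%E.
  by apply: nneseries_ge0 => j _ _; exact: sqnorm_ge0.
rewrite -ler_sqr ?nnegrE ?mulr_ge0 ?rnorm_ge0 ?sqrtr_ge0//.
rewrite exprMn [X in _ <= X * _]sqr_sqrtr ?fine_ge0// mulrC.
have := sqnorm_apply_le c.
rewrite -[X in (_ <= _ * X)%E]fineK ?ge0_fin_numE// -EFinM.
rewrite -[X in (X <= _)%E](fineK (sqnorm_fin (matrix_operator wd c))) lee_fin.
by rewrite fine_sqnormE.
Qed.

Lemma hilbert_schmidt_compact (wd : well_defined_on_ell2 a) :
  compact_operator (matrix_operator wd).
Proof.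
move=> A [M [Mreal MA]].
(* Boundedness of [A] provides a norm bound by every number strictly above the real [M], which may
   be negative; this choice exceeds [M] and is nonnegative. *)
pose K := rnorm M + 1.
have K0 : 0 <= K by rewrite addr_ge0 ?rnorm_ge0.
have AK c : A c -> rnorm c <= K.
  rewrite -lecR rnormE; apply: MA.
  apply: (@le_lt_trans _ _ (rnorm M)%:C); last by rewrite ltcR ltrDl.
  by rewrite rnormE real_ler_norm.
(* This is [K] times the l^2 norm of row j, hence square summable by [aoo]. *)
pose s j := Num.sqrt (K ^+ 2 * fine (sqnorm (a j))).
have sE j : s j ^+ 2 = K ^+ 2 * fine (sqnorm (a j)).
  by rewrite sqr_sqrtr// mulr_ge0 ?sqr_ge0// fine_ge0// sqnorm_ge0.
have pcube : precompact [set y : ell2 R | forall j, rnorm (y j) <= s j].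
  apply: precompact_hilbert_cube.
  under eq_eseriesr do rewrite sE EFinM row_fin.
  rewrite nneseriesZl => [|j _]; last exact: sqnorm_ge0.
  by rewrite lte_mul_pinfty// lee_fin sqr_ge0.
apply: precompact_subset pcube => _ [c Ac <-] j /=.
rewrite -ler_sqr ?nnegrE ?rnorm_ge0 ?sqrtr_ge0// sE.
apply: le_trans (rnorm_apply_le c j) _.
rewrite ler_wpM2r ?fine_ge0 ?sqnorm_ge0// ler_sqr ?nnegrE ?rnorm_ge0//.
exact: AK.
Qed.

End hilbert_schmidt.

(** Tonelli turns the sum over rows into a sum over columns; column k then contributes the Bessel
    sum of [g] at [f k]. *)
Lemma cross_gram_hilbert_schmidt (R : realType) (H : normedModType R[i])
    (ip : H -> H -> R[i]) (f g : nat -> H) (B : R) : bessel_sequence ip g B ->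
  (\sum_(0 <= k <oo) (rnorm (f k) ^+ 2)%:E < +oo)%E ->
  (\sum_(0 <= j <oo) sqnorm (cross_gram ip f g j) < +oo)%E.
Proof.
move=> [B0 gB] foo; rewrite /sqnorm nneseries_interchange => [|j k]; last first.
  by rewrite lee_fin sqr_ge0.
apply: (@le_lt_trans _ _ (B%:E * \sum_(0 <= k <oo) (rnorm (f k) ^+ 2)%:E)%E).
  rewrite -nneseriesZl => [|k _]; last by rewrite lee_fin sqr_ge0.
  apply: lee_nneseries => k _; last by rewrite -EFinM; exact: gB.
  by move=> _; apply: nneseries_ge0 => j _ _; rewrite lee_fin sqr_ge0.
by rewrite lte_mul_pinfty// lee_fin ltW.
Qed.

Theorem theorem2p3 (R : realType) (H : completeNormedModType R[i])
    (ip : {dot H for Num.conj}) (ip_norm : forall x : H, ip x x = `|x| ^+ 2)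
    (f g : nat -> H) (B' : R) (g_bessel : bessel_sequence ip g B')
    (f_summable : exists2 M : R, 0 < M &
       (\sum_(0 <= k <oo) (rnorm (f k) ^+ 2)%:E <= M%:E)%E) :
  exists G_wd : well_defined_on_ell2 (cross_gram ip f g),
    bounded_operator (matrix_operator G_wd) /\
    compact_operator (matrix_operator G_wd).
Proof.
have [M _ fM] := f_summable.
have aoo := cross_gram_hilbert_schmidt g_bessel (le_lt_trans fM (ltry M)).
exists (hilbert_schmidt_well_defined aoo); split.
  exact: hilbert_schmidt_bounded.
exact: hilbert_schmidt_compact.
Qed.
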